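(* The Grushin plane $\mathbb{G}$ equipped with the Carnot--Carathéodory distance $d_{\mathbb{G}}$ admits a bi-Lipschitz embedding into some Euclidean space $\mathbb{R}^N$. Moreover, the bi-Lipschitz constant of the embedding and the dimension $N$ depend only on a bi-Lipschitz constant $L$ of a bi-Lipschitz embedding of the singular line $(A,d_{\mathbb{G}})$ into $\mathbb{R}^3$; that is, whenever $L\ge 1$ is such that there is a map $f:A\to\mathbb{R}^3$ with $\frac1L d_{\mathbb{G}}(p,q)\le |f(p)-f(q)|\le L\, d_{\mathbb{G}}(p,q)$ for all $p,q\in A$, the embedding can be chosen with dimension $N=N(L)$ and bi-Lipschitz constant $C(L)$ depending only on $L$.
   Context: The Grushin plane $\mathbb{G}$ is $\mathbb{R}^2$ with the horizontal distribution spanned by the vector fields $X_1=\frac{\partial}{\partial x}$ and $X_2=x\frac{\partial}{\partial y}$. A horizontal curve is an absolutely continuous curve $\gamma$ tangent to the distribution, i.e. $\gamma'(t)=a(t)X_1(\gamma(t))+b(t)X_2(\gamma(t))$ for a.e. $t$; its length is computed with $X_1,X_2$ orthonormal, so off the line $x=0$ it is the length for the Riemannian metric $ds^2=dx^2+x^{-2}dy^2$. The Carnot--Carathéodory distance $d_{\mathbb{G}}(p,q)$ is the infimum of the lengths of horizontal curves joining $p$ to $q$ (it is finite for all $p,q$). The singular line is $A=\{(x,y): x=0\}$, with the restriction of $d_{\mathbb{G}}$. A map $F:(X,d_X)\to(Y,d_Y)$ is bi-Lipschitz with constant $C\ge1$ if $\frac1C d_X(x,y)\le d_Y(F(x),F(y))\le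 C d_X(x,y)$ for all $x,y\in X$. Euclidean spaces carry the Euclidean distance. *)

(* Defs.v *)
From HB Require Import structures.
From mathcomp Require Import all_boot all_order all_algebra.
From mathcomp Require Import all_classical all_reals all_analysis.
Set Implicit Arguments.
Unset Strict Implicit.
Unset Printing Implicit Defensive.
Import Order.TTheory GRing.Theory Num.Theory.
Import numFieldNormedType.Exports.
Local Open Scope classical_set_scope.
Local Open Scope ring_scope.

(* The library norm on 'rV[R]_N is the sup norm, hence the explicit formula. *)
Definition euclidean_dist (R : realType) (N : nat) (u v : 'rV[R]_N) : R :=
  Num.sqrt (\sum_(i < N) (u ord0 i - v ord0 i) ^+ 2).

(* Distances are extended reals so that an infimum of lengths is never a
   default value; either inequality with a finite right-hand side also forces
   the source distance to be finite. *)
Definition bilipschitz_on (R : realType) (X Y : Type) (D : set X)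
    (dX : X -> X -> \bar R) (dY : Y -> Y -> \bar R) (C : R) (F : X -> Y) : Prop :=
  1 <= C /\
  forall p q : X, D p -> D q ->
    ((C^-1)%:E * dX p q <= dY (F p) (F q))%E /\
    (dY (F p) (F q) <= C%:E * dX p q)%E.

Definition absolutely_continuous (R : realType) (V : normedModType R)
    (a b : R) (f : R -> V) : Prop :=
  forall e : R, 0 < e -> exists2 d : R, 0 < d &
    forall (n : nat) (s t : 'I_n -> R),
      (forall i, [/\ a <= s i, s i <= t i & t i <= b]) ->
      trivIset [set: 'I_n] (fun i => [set` `]s i, t i[]) ->
      \sum_(i < n) (t i - s i) < d ->
      \sum_(i < n) `|f (t i) - f (s i)| < e.

Definition grushin_X1 (R : realType) (p : R * R) : R * R := (1, 0).

Definition grushin_X2 (R : realType) (p : R * R) : R * R := (0, p.1).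

(* The norm on the distribution for which X1, X2 are orthonormal. It is +oo on
   non-horizontal vectors; where x = 0 the coefficient of X2 is not determined
   by v, and the infimum takes it to be 0. *)
Definition grushin_norm (R : realType) (p v : R * R) : \bar R :=
  ereal_inf [set l | exists al be : R,
    v = al *: grushin_X1 p + be *: grushin_X2 p /\
    l = (Num.sqrt (al ^+ 2 + be ^+ 2))%:E].

Definition horizontal_curve (R : realType) (a b : R) (g : R -> R * R) : Prop :=
  absolutely_continuous a b g /\
  {ae lebesgue_measure, forall t : R, a < t < b ->
    derivable g t 1 /\
    exists al be : R,
      g^`()%classic t = al *: grushin_X1 (g t) + be *: grushin_X2 (g t)}.

Definition grushin_length (R : realType) (a b : R) (g : R -> R * R) : \bar R :=
  (\int[lebesgue_measure]_(t in `]a, b[) grushin_norm (g t) (g^`()%classic t))%E.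

Definition grushin_dist (R : realType) (p q : R * R) : \bar R :=
  ereal_inf [set l | exists (a b : R) (g : R -> R * R),
    [/\ a < b, horizontal_curve a b g, g a = p, g b = q &
        l = grushin_length a b g]].

Definition singular_line (R : realType) : set (R * R) := [set p | p.1 = 0].

Arguments singular_line R : clear implicits.

Definition grushin_bilipschitz_on (R : realType) (D : set (R * R)) (N : nat)
    (C : R) (F : R * R -> 'rV[R]_N) : Prop :=
  bilipschitz_on D (@grushin_dist R)
    (fun u v : 'rV[R]_N => (euclidean_dist u v)%:E) C F.

(* Main.v *)
Require Import Defs.
From HB Require Import structures.
From mathcomp Require Import all_boot all_order all_algebra.
From mathcomp Require Import all_classical all_reals all_analysis.
From mathcomp Require Import measurable_realfun ring lra.
Set Implicit Arguments.
Unset Strict Implicit.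
Unset Printing Implicit Defensive.
Import Order.TTheory GRing.Theory Num.Theory.
Import numFieldNormedType.Exports.
Local Open Scope classical_set_scope.
Local Open Scope ring_scope.

(** The Grushin distance is comparable to an explicit gauge.  For points
    [p = (x, y)], [q = (x', y')] put [D = |y - y'|] and
    [X = max (sqrt D) |x| |x'|] ([grushin_scale]).  Then
    [|x - x'| + D / X] ([grushin_gauge]) is equivalent to the distance: at
    horizontal distance about [X] from the singular line, a vertical
    displacement [D] costs about [D / X], and when [D] exceeds the square of
    the distance to the line it is cheaper to move away to [sqrt D] first.

    The gauge is at most 3 times the distance ([gauge_le_dist]) because along
    a horizontal curve of length [l] the coordinate [x] moves by at most [l],
    so [|x|] stays below [|x| + l] and [y] moves by at most [(|x| + l) l].
    Both estimates need [|f b - f a| <= \int |f'|] for an absolutely continuous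
    [f] ([ac_increment_le_integral]).  Conversely ([dist_le_gauge]) a curve
    whose first coordinate is a quadratic polynomial, bent away from the
    singular line by [D / X], has length at most 8 times the gauge.

    The gauge is then embedded by an Assouad-type series
      [(x, y) |-> \sum_n h_{s_n}(x) psi(y / s_n^2)],  [s_n = 2^r 64^n],
    over all integers [n], where [psi] is [sin] or [cos - 1] and [h_s] is a
    cutoff equal to [s] for [|x| <= s] and to [0] for [|x| >= 2 s].
    The levels with [s_n] much smaller than [|x|] vanish,
    which makes the series as smooth in [y] as the gauge is.
    Every such series is Lipschitz ([level_sum_increment_le]).  If [s_n] lies in
    [[X, 2 X]] and [|x - x'|] is small, level [n] changes by about [D / X] for
    one of the two waves, and since consecutive scales differ by the factor 64
    the other levels together cannot cancel that change
    ([level_sum_increment_ge]).  The six shifts [r < 6] place some [s_n] in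
    every such interval, so [x] and twelve series give an embedding into
    dimension 13.  Its constants are absolute, hence may serve for every [L]. *)

(** * Absolutely continuous functions and their derivatives *)

Lemma derivable_increment (R : realType) (f : R -> R) (t e : R) :
  derivable f t 1 -> 0 < e ->
  exists2 d : R, 0 < d &
    forall h : R, `|h| < d -> `|f (t + h) - f t - h * f^`()%classic t| <= e * `|h|.
Proof.
move=> df e0; have : (h^-1 *: (f (h + t) - f t)) @[h --> 0^'] --> f^`()%classic t.
  move: df; rewrite /derivable /derive1.
  under eq_fun do rewrite /= [_%:A]mulr1.
  by [].
move/cvgrPdist_lt => /(_ e e0); rewrite /prop_near1 /= => -[d /= d0 H].
exists d => // h hd; have [->|h0] := eqVneq h 0.
  by rewrite addr0 subrr mul0r subrr normr0 mulr0.
have := H h; rewrite /ball /= sub0r normrN => /(_ hd h0) /ltW.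
rewrite [X in _ -> X <= _](_ : _ = `|f^`()%classic t - h^-1 * (f (h + t) - f t)| * `|h|).
  by move=> ?; apply: ler_wpM2r.
by rewrite -normrM -normrN [h + t]addrC; congr (`|_|); field.
Qed.

(** A real form of Cousin's covering lemma: the least upper bound of the points
    satisfying [P] satisfies [P], and cannot be smaller than [b]. *)
Lemma continuous_induction (R : realType) (a b : R) (P : R -> Prop) :
  a <= b -> P a ->
  (forall t, a <= t <= b -> exists2 d : R, 0 < d &
     (forall u, a <= u <= t -> t - d < u -> P u -> P t) /\
     (forall v, t <= v <= b -> v < t + d -> P t -> P v)) ->
  P b.
Proof.
move=> ab Pa step; pose S := [set t | a <= t <= b /\ P t].
have Sa : S a by split=> //; rewrite lexx.
have hs : has_sup S by split; [exists a|exists b => t [/andP[]]].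
set c := sup S.
have ac : a <= c by apply: sup_upper_bound.
have cb : c <= b by apply: ge_sup; [exists a|move=> t [/andP[]]].
have [d d0 [stepl stepr]] := step c (introT andP (conj ac cb)).
have Pc : P c.
  have [u [/andP[au ub] Pu] cu] := sup_adherent d0 hs.
  apply: (stepl u) => //; rewrite au /=; apply: sup_upper_bound => //.
  by split=> //; rewrite au.
have [<- //|cb'] := eqVneq c b.
pose v := Num.min b (c + d / 2).
have cv : c < v by rewrite /v lt_min lt_neqAle cb' cb /=; lra.
have vb : v <= b by rewrite /v ge_min lexx.
have vd : v < c + d by rewrite /v gt_min; apply/orP; right; lra.
have Pv : P v by apply: stepr => //; rewrite vb ltW.
have : v <= c by apply: sup_upper_bound => //; split => //; rewrite vb; lra.
lra.
Qed.

Lemma ord_max_or_widen (n : nat) (i : 'I_n.+1) :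
  i = ord_max \/ exists j, i = widen_ord (leqnSn n) j.
Proof.
have := ltn_ord i; rewrite ltnS leq_eqVlt => /orP[/eqP ii|ii].
  by left; apply: val_inj.
by right; exists (Ordinal ii); apply: val_inj.
Qed.

Lemma trivIset_ord_recr (T : Type) (n : nat) (F : 'I_n.+1 -> set T) :
  trivIset setT (fun i : 'I_n => F (widen_ord (leqnSn n) i)) ->
  (forall i : 'I_n, F (widen_ord (leqnSn n) i) `&` F ord_max = set0) ->
  trivIset setT F.
Proof.
move=> tF Fm; have w := @ord_max_or_widen n.
move=> i j _ _; have [->|[i' ->]] := w i; have [->|[j' ->]] := w j => //.
- by rewrite setIC Fm => -[].
- by rewrite Fm => -[].
- by move=> /tF -> //.
Qed.

Section increment.
Variables (R : realType) (a b : R) (f : R -> R) (G : R -> R).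

(** The finite families to which absolute continuity will be applied, inside
    [[a, t]] and inside a set [O] which will be open and of small measure. *)
Definition packed (O : set R) (t : R) (n : nat) (s u : 'I_n -> R) :=
  [/\ forall i, [/\ a <= s i, s i <= u i & u i <= t],
      trivIset [set: 'I_n] (fun i => [set` `]s i, u i[]) &
      forall i, [set` `]s i, u i[] `<=` O].

Lemma packed_length (O : set R) (d t : R) n (s u : 'I_n -> R) :
  open O -> (lebesgue_measure O < d%:E)%E -> packed O t s u ->
  \sum_(i < n) (u i - s i) < d.
Proof.
move=> oO Od [su tr sub]; rewrite -lte_fin; apply: le_lt_trans Od.
rewrite -sumEFin.
rewrite (eq_bigr (fun i => lebesgue_measure [set` `]s i, u i[])); last first.
  move=> i _; have [_ su_i _] := su i; rewrite lebesgue_measure_itv /= lte_fin.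
  have [//|us] := ltP (s i) (u i).
  have -> : u i = s i by apply/le_anti/andP.
  by rewrite subrr.
rewrite -(@measure_bigsetU_ord _ _ _ _ _ xpredT) //.
apply: le_measure; rewrite ?inE.
- by apply: bigsetU_measurable => i _; exact: measurable_itv.
- exact: open_measurable.
- by elim/big_ind : _ => // A B AO BO; rewrite subUset.
Qed.

Lemma packed_widen (O : set R) (t v : R) n (s u : 'I_n -> R) :
  t <= v -> packed O t s u -> packed O v s u.
Proof.
move=> tv [su tr sub]; split=> // i; have [? ? ?] := su i; split=> //.
exact: le_trans tv.
Qed.

Lemma packed_rcons (O : set R) (t v : R) n (s u : 'I_n -> R) :
  a <= t <= v -> `]t, v[ `<=` O -> packed O t s u ->
  exists s' u' : 'I_n.+1 -> R, packed O v s' u' /\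
    \sum_(i < n.+1) `|f (u' i) - f (s' i)| =
    \sum_(i < n) `|f (u i) - f (s i)| + `|f v - f t|.
Proof.
move=> /andP[at_ tv] tO [su tr sub].
pose ext (w : 'I_n -> R) (z : R) (i : 'I_n.+1) :=
  if unlift ord_max i is Some j then w j else z.
have extl w z j : ext w z (widen_ord (leqnSn n) j) = w j.
  rewrite /ext; have -> : widen_ord (leqnSn n) j = lift ord_max j.
    by apply: val_inj; rewrite /= /bump leqNgt ltn_ord.
  by rewrite liftK.
have extr w z : ext w z ord_max = z by rewrite /ext unlift_none.
have cases := @ord_max_or_widen n.
exists (ext s t), (ext u v); split; last first.
  rewrite big_ord_recr /= !extr; congr (_ + _).
  by apply: eq_bigr => i _; rewrite !extl.
split.
- move=> i; have [->|[j ->]] := cases i; first by rewrite !extr.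
  by rewrite !extl; have [? ? ?] := su j; split=> //; exact: le_trans tv.
- apply: trivIset_ord_recr => [|i].
    by under eq_fun do rewrite !extl.
  rewrite !extl !extr -subset0 => x /= []; rewrite !in_itv /= => /andP[_ xu] /andP[tx _].
  by have [_ _ ut] := su i; have := lt_trans (lt_le_trans xu ut) tx; rewrite ltxx.
- move=> i; have [->|[j ->]] := cases i; first by rewrite !extr.
  by rewrite !extl.
Qed.

(** Let [W] be the null set where the derivatives fail to exist or to compare,
    together with the end points, and let [V] be an open set of small measure
    containing [W].  Advancing from [a] to [b] by continuous induction, a step
    near a point outside [W] increases [|f - f a|] by at most the increment of
    [G], up to [2 * e1] times the length of the step; a step near a point of
    [W] is an interval inside [V], and by absolute continuity all such steps
    together contribute less than [e1].  On the latter steps only the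
    monotonicity of [G] is used. *)
Lemma ac_increment_le : a <= b -> absolutely_continuous a b f ->
  (forall t u, t <= u -> G t <= G u) ->
  {ae lebesgue_measure, forall t : R, a < t < b ->
     [/\ derivable f t 1, derivable G t 1 & `|f^`()%classic t| <= G^`()%classic t]} ->
  `|f b - f a| <= G b - G a.
Proof.
move=> ab acf ndG [Z [mZ Z0 sub]]; apply/ler_addgt0Pl => e e0.
(* the total error is [e1 + 2 * e1 * (b - a)], which is at most [e] *)
pose e1 := e / (2 + 2 * (b - a)).
have e10 : 0 < e1 by apply: divr_gt0 => //; lra.
have [d d0 acd] := acf e1 e10.
pose W := Z `|` [set a; b].
have W0 : lebesgue_measure W = 0%E.
  apply: null_set_setU => //; first exact: measurableU.
  apply: null_set_setU => //; exact: lebesgue_measure_set1.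
have mW : measurable W by apply: measurableU => //; apply: measurableU.
have Woo : (lebesgue_measure W < +oo)%E by rewrite W0 ltry.
have [V [oO WO mO]] := lebesgue_regularity_outer mW Woo d0.
have Od : (lebesgue_measure V < d%:E)%E.
  have -> : lebesgue_measure V = (lebesgue_measure (V `\` W) + lebesgue_measure (V `&` W))%E.
    by apply: measureDI => //; exact: open_measurable.
  by rewrite setIC (setIidl WO) W0 adde0.
pose P t := exists n (s u : 'I_n -> R), packed V t s u /\
  `|f t - f a| <= \sum_(i < n) `|f (u i) - f (s i)| + (G t - G a) + 2 * e1 * (t - a).
(* a step near a good point keeps the family of bad intervals *)
have Pgood t v : t <= v -> `|f v - f t| <= G v - G t + 2 * e1 * (v - t) -> P t -> P v.
  move=> tv H [n [s [u [pk fle]]]]; exists n, s, u; split; first exact: packed_widen pk.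
  have := ler_distD (f t) (f v) (f a); lra.
(* a step inside [V] is added to the family of bad intervals *)
have Pbad t v : a <= t <= v -> `]t, v[ `<=` V -> P t -> P v.
  move=> /andP[at_ tv] H [n [s [u [pk fle]]]].
  have [|s' [u' [pk' E]]] := packed_rcons _ H pk; first by rewrite at_.
  exists n.+1, s', u'; split=> //; rewrite E.
  have := ler_distD (f t) (f v) (f a); have := ndG _ _ tv.
  have : 0 <= e1 * (v - t) by apply: mulr_ge0; lra.
  lra.
have : P b.
  apply: (continuous_induction ab).
    exists 0%N, (fun=> 0), (fun=> 0); split.
      split; [by case|by case|by case].
    by rewrite big_ord0 !subrr normr0 mulr0 !addr0.
  move=> t /andP[at_ tb].
  have [Wt|Wt] := pselect (W t).
    have : nbhs t V by apply: open_nbhs_nbhs; split=> //; exact: WO.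
    move=> /nbhs_ballP[r /= r0 Or]; exists r => //; split.
      move=> u /andP[au ut] tr; apply: Pbad; first by rewrite au.
      move=> x /=; rewrite in_itv /= => /andP[ux xt]; apply: Or.
      by rewrite /ball /= ger0_norm; lra.
    move=> v /andP[tv vb] vt; apply: Pbad; first by rewrite at_.
    move=> x /=; rewrite in_itv /= => /andP[tx xv]; apply: Or.
    by rewrite /ball /= ler0_norm; lra.
  have tab : a < t < b.
    rewrite !lt_neqAle at_ tb !andbT; apply/andP; split; apply/eqP => E; apply: Wt; right.
      by left.
    by right.
  have good : a < t < b ->
      [/\ derivable f t 1, derivable G t 1 & `|f^`()%classic t| <= G^`()%classic t].
    by apply: contrapT => H; apply: Wt; left; exact: sub.
  have [df dG fG] := good tab.
  have [d1 d10 H1] := derivable_increment df e10.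
  have [d2 d20 H2] := derivable_increment dG e10.
  have H h : `|h| < Num.min d1 d2 -> `|f (t + h) - f t| <= `|G (t + h) - G t| + 2 * e1 * `|h|.
    rewrite lt_min => /andP[h1 h2]; have := H1 h h1; have := H2 h h2.
    have -> : `|f (t + h) - f t| = `|f (t + h) - f t - h * f^`()%classic t + h * f^`()%classic t|.
      by rewrite subrK.
    have := ler_normD (f (t + h) - f t - h * f^`()%classic t) (h * f^`()%classic t).
    have := ler_normB (G (t + h) - G t) (G (t + h) - G t - h * G^`()%classic t).
    rewrite subKr !normrM [`|G^`()%classic t|]ger0_norm ?(le_trans _ fG) //.
    have := ler_wpM2l (normr_ge0 h) fG; lra.
  exists (Num.min d1 d2); first by rewrite lt_min d10.
  split.
    move=> u /andP[au ut] tu; apply: Pgood => //.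
    have := H (u - t); rewrite (_ : t + (u - t) = u); last by ring.
    rewrite [`|u - t|]distrC [`|t - u|]ger0_norm ?subr_ge0 //.
    rewrite [`|f u - _|]distrC [`|G u - _|]distrC [`|G t - _|]ger0_norm ?subr_ge0 ?ndG //.
    by apply; lra.
  move=> v /andP[tv vb] vt; apply: Pgood => //.
  have := H (v - t); rewrite (_ : t + (v - t) = v); last by ring.
  rewrite [`|G v - _|]ger0_norm ?[`|v - t|]ger0_norm ?subr_ge0 ?ndG //.
  by apply; lra.
move=> [n [s [u [pk]]]].
have [su tr _] := pk.
have : \sum_(i < n) `|f (u i) - f (s i)| < e1.
  by apply: acd => //; apply: packed_length oO Od pk.
have : e = 2 * e1 + 2 * e1 * (b - a).
  rewrite /e1; field; lra.
lra.
Qed.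
End increment.

(** The integral of a nonnegative function is a supremum over simple functions
    below it, so monotonicity needs no measurability.  This matters for
    [t |-> grushin_norm (g t) (g' t)], about which nothing is known at the points
    where [g] has no derivative. *)
Lemma ge0_le_integral_nonmeasurable d (T : measurableType d) (R : realType)
    (mu : {measure set T -> \bar R}) (D : set T) (f g : T -> \bar R) :
  (forall x, D x -> (0 <= f x <= g x)%E) ->
  (\int[mu]_(x in D) f x <= \int[mu]_(x in D) g x)%E.
Proof.
move=> fg; rewrite !ge0_integralE.
- apply: le_ereal_sup => _ [h /= hf <-]; exists h => // x; apply: le_trans (hf x) _.
  by rewrite /patch; case: ifPn => // /[1!inE] /fg /andP[].
- by move=> x /fg /andP[f0 /(le_trans f0)].
- by move=> x /fg /andP[].
Qed.

Section increment_integral.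
Variables (R : realType) (a b : R) (f : R -> R).
Hypotheses (ab : a < b) (acf : absolutely_continuous a b f).

(* Extending [f] by constants makes the difference quotients below defined and
   continuous on the whole line. *)
Let clamp (t : R) : R := Num.max a (Num.min b t).

Let clamp_id t : a <= t <= b -> clamp t = t.
Proof. by move=> /andP[at_ tb]; rewrite /clamp min_r // max_r. Qed.

Let ac_uniform (e : R) : 0 < e -> exists2 d : R, 0 < d &
  forall s t, a <= s -> s <= t -> t <= b -> t - s < d -> `|f t - f s| < e.
Proof.
move=> e0; have [d d0 H] := acf e0; exists d => // s t as_ st tb tsd.
have := H 1%N (fun=> s) (fun=> t); rewrite !big_ord1; apply => //.
by move=> i j _ _ _; rewrite !ord1.
Qed.

Let clamp_continuous : continuous (f \o clamp).
Proof.
move=> t; apply/cvgrPdist_lt => e e0; have [d d0 H] := ac_uniform e0.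
exists d => //= u; rewrite /ball /= => tu.
wlog tu' : t u tu / t <= u.
  move=> W; have [|/ltW] := leP t u; first exact: W.
  by move=> ut; rewrite distrC; apply: W => //; rewrite distrC.
rewrite distrC; apply: H.
- by rewrite /clamp le_max lexx.
- by rewrite /clamp /Num.max /Num.min; repeat case: ifPn; lra.
- by rewrite /clamp ge_max ltW //= ge_min lexx.
- move: tu; rewrite ler0_norm ?subr_le0 // opprB.
  by rewrite /clamp /Num.max /Num.min; repeat case: ifPn; lra.
Qed.

Let quot (n : nat) (t : R) : R :=
  n.+1%:R * `|f (clamp (t + n.+1%:R^-1)) - f (clamp t)|.

Let quot_measurable n : measurable_fun setT (quot n).
Proof.
apply: continuous_measurable_fun => t; apply: cvgM; first exact: cvg_cst.
apply: cvg_norm; apply: cvgB; last exact: clamp_continuous.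
have shift_continuous : continuous (fun u : R => u + n.+1%:R^-1).
  by move=> u; apply: cvgD; [exact: cvg_id|exact: cvg_cst].
exact: (continuous_comp (@shift_continuous t) (@clamp_continuous _)).
Qed.

Let quot_cvg t : a < t < b -> derivable f t 1 ->
  quot n t @[n --> \oo] --> `|f^`()%classic t|.
Proof.
move=> /andP[at_ tb] df; apply/cvgrPdist_le => e e0.
have [d d0 H] := derivable_increment df e0.
have m0 : 0 < Num.min d (b - t) by rewrite lt_min d0 subr_gt0.
near=> n.
have n0 : (0 : R) < n.+1%:R by [].
have nd : n.+1%:R^-1 < Num.min d (b - t).
  by near: n; exact: (near_infty_natSinv_lt (PosNum m0)).
move: nd; rewrite lt_min => /andP[nd nb].
have ni : (0 : R) < n.+1%:R^-1 by rewrite invr_gt0.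
rewrite /quot !clamp_id; last 2 first.
  by rewrite (ltW at_) ltW.
  by rewrite -lerBrDl (ltW nb) andbT (le_trans (ltW at_)) // lerDl ltW.
have := H n.+1%:R^-1; rewrite [`|n.+1%:R^-1|]gtr0_norm // => /(_ nd) /(ler_wpM2l (ltW n0)).
rewrite mulrCA divff ?lt0r_neq0 // mulr1; apply: le_trans.
rewrite -[X in X * `|f _ - _|](gtr0_norm n0) -[X in _ <= X * `|f _ - _ - _|](gtr0_norm n0) -!normrM.
apply: le_trans (ler_dist_dist _ _) _.
by rewrite distrC [in leRHS]mulrBr mulVKf ?lt0r_neq0.
Unshelve. all: by end_near. Qed.

(** The derivative [D] of [f], cut off to the full-measure part of [[a, b]] where
    it is controlled by [h], is a limit of measurable difference quotients, hence
    measurable, and then integrable because [h] has a finite integral.  By the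
    Lebesgue differentiation theorem its primitive has derivative [D] almost
    everywhere, so [ac_increment_le] applies to [f] and this primitive. *)
Lemma ac_increment_le_integral (h : R -> \bar R) (c l : R) : 0 < c ->
  (forall t, (0 <= h t)%E) ->
  {ae lebesgue_measure, forall t : R, a < t < b ->
     derivable f t 1 /\ ((c^-1 * `|f^`()%classic t|)%:E <= h t)%E} ->
  (\int[lebesgue_measure]_(t in `]a, b[) h t <= l%:E)%E ->
  `|f b - f a| <= c * l.
Proof.
move=> c0 h0 H hl; have [Z [mZ Z0 sub]] := H.
pose A := `]a, b[ `\` Z.
have mA : measurable A by apply: measurableD.
have good t : A t -> [/\ a < t < b, derivable f t 1 & ((c^-1 * `|f^`()%classic t|)%:E <= h t)%E].
  move=> [/=]; rewrite in_itv /= => tab nZ.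
  have : a < t < b -> derivable f t 1 /\ ((c^-1 * `|f^`()%classic t|)%:E <= h t)%E.
    by apply: contrapT => N; apply: nZ; exact: sub.
  by move=> /(_ tab)[].
pose D := (fun t => `|f^`()%classic t|) \_ A.
have D0 t : 0 <= D t by rewrite /D /patch; case: ifP.
have mD : measurable_fun setT (EFin \o D).
  rewrite /D -restrict_EFin; apply/(measurable_restrictT _ _).1 => //.
  apply: (@emeasurable_fun_cvg _ _ _ _ (fun n => EFin \o quot n)).
    move=> n; apply/measurable_EFinP; apply: measurable_funS (quot_measurable n) => //.
  move=> t /good [tab df _]; apply/cvg_EFin => //; first exact: nearW.
  exact: quot_cvg.
have intD : (\int[lebesgue_measure]_t (D t)%:E <= (c * l)%:E)%E.
  apply: (@le_trans _ _ (c%:E * \int[lebesgue_measure]_t (c^-1 * D t)%:E)%E); last first.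
    rewrite EFinM; apply: lee_wpmul2l; first by rewrite lee_fin ltW.
    apply: le_trans hl; rewrite [leRHS]integral_mkcond.
    apply: ge0_le_integral_nonmeasurable => t _; apply/andP; split.
      by rewrite lee_fin mulr_ge0 // invr_ge0 ltW.
    rewrite /D /patch; case: ifPn => [|_]; last first.
      by rewrite mulr0; case: ifP.
    rewrite inE => /[dup] -[/= tab _] /good[_ _].
    by rewrite mem_set.
  rewrite -ge0_integralZl_EFin //; last first.
  - by rewrite ltW.
  - by under eq_fun do rewrite EFinM; apply: measurable_funeM.
  - by move=> t _; rewrite lee_fin mulr_ge0 // invr_ge0 ltW.
  rewrite le_eqVlt; apply/orP; left; apply/eqP; apply: eq_integral => t _.
  by rewrite -EFinM mulrA divff ?mul1r // lt0r_neq0.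
have iD : lebesgue_measure.-integrable setT (EFin \o D).
  apply/integrableP; split => //.
  under eq_integral do rewrite /= ger0_norm //.
  exact: le_lt_trans intD (ltry _).
have iDS (E : set R) : measurable E -> lebesgue_measure.-integrable E (EFin \o D).
  by move=> mE; apply: integrableS iD.
pose G (x : R) := (\int[lebesgue_measure]_(t in `]-oo, x]) D t)%R.
have ftc := FTC1Ny (fun y => iDS _ (measurable_itv `]-oo, y])) (open_integrable_locally openT iD).
have ndG t u : t <= u -> G t <= G u.
  move=> tu; apply: fine_le.
  - by apply: integrable_fin_num => //; exact: iDS.
  - by apply: integrable_fin_num => //; exact: iDS.
  apply: ge0_subset_integral => //.
  - by apply: (measurable_funS measurableT) => //; apply/measurable_EFinP; exact/measurable_EFinP.
  - by move=> x _; rewrite lee_fin.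
  by apply: subset_itvl; rewrite bnd_simp.
have Ga : 0 <= G a by apply: Rintegral_ge0.
have Gb : G b <= c * l.
  rewrite -lee_fin fineK; last by apply: integrable_fin_num => //; exact: iDS.
  apply: le_trans intD; apply: ge0_subset_integral => //.
  by move=> x _; rewrite lee_fin.
apply: (@le_trans _ _ (G b - G a)); last by lra.
apply: ac_increment_le => //; first exact: ltW.
have nZ : {ae lebesgue_measure, forall t : R, ~ Z t}.
  by exists Z; split => // t /= /contrapT.
move: ftc nZ; apply: filterS2; first exact: (ae_filter_ringOfSetsType lebesgue_measure).
move=> t [dG GE] nZ tab.
have At : A t by split => //=; rewrite in_itv.
have [_ df _] := good t At; split => //.
by rewrite GE /D /patch mem_set.
Qed.
End increment_integral.

(** * Lower bound for the Grushin distance *)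

Lemma cvg_fst_snd (R : realType) (T : Type) (F : set_system T) (f : T -> R * R) (l : R * R) :
  Filter F ->
  f x @[x --> F] --> l -> ((f x).1 @[x --> F] --> l.1) /\ ((f x).2 @[x --> F] --> l.2).
Proof.
move=> FF fl; split; apply: (cvg_comp _ _ fl).
- by case: l {fl} => l1 l2; exact: cvg_fst.
- by case: l {fl} => l1 l2; exact: cvg_snd.
Qed.

Lemma derive1_fst_snd (R : realType) (g : R -> R * R) (t : R) : derivable g t 1 ->
  [/\ derivable (fst \o g) t 1, (fst \o g)^`()%classic t = (g^`()%classic t).1,
      derivable (snd \o g) t 1 & (snd \o g)^`()%classic t = (g^`()%classic t).2].
Proof.
move=> dg; have E : g^`()%classic t = lim ((fun h : R => h^-1 *: (g (h *: 1 + t) - g t)) @ 0^').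
  by rewrite derive1E.
have [c1 c2] := cvg_fst_snd _ dg.
split.
- by apply: cvgP; exact: c1.
- by rewrite derive1E E; apply: cvg_lim => //; exact: c1.
- by apply: cvgP; exact: c2.
- by rewrite derive1E E; apply: cvg_lim => //; exact: c2.
Qed.

Lemma ac_fst_snd (R : realType) (a b : R) (g : R -> R * R) : absolutely_continuous a b g ->
  absolutely_continuous a b (fst \o g) /\ absolutely_continuous a b (snd \o g).
Proof.
by move=> acg; split => e e0; have [d d0 H] := acg e e0; exists d => // n s t st tr sd;
  apply: le_lt_trans (H n s t st tr sd); apply: ler_sum => i _;
  rewrite prod_normE le_max lexx ?orbT.
Qed.

Lemma ac_subitv (R : realType) (V : normedModType R) (a b c : R) (f : R -> V) : c <= b ->
  absolutely_continuous a b f -> absolutely_continuous a c f.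
Proof.
move=> cb acf e /acf [d d0 H]; exists d => // n s t st tr; apply: H => // i.
by have [? ? ?] := st i; split => //; exact: le_trans cb.
Qed.

Section norm.
Variable R : realType.
Implicit Types p v : R * R.

Lemma grushin_combination p (al be : R) :
  al *: grushin_X1 p + be *: grushin_X2 p = (al, be * p.1).
Proof.
rewrite /grushin_X1 /grushin_X2; congr pair.
  by rewrite -[LHS]/(al * 1 + be * 0) mulr1 mulr0 addr0.
by rewrite -[LHS]/(al * 0 + be * p.1) mulr0 add0r.
Qed.

Lemma grushin_norm_ge0 p v : (0 <= grushin_norm p v)%E.
Proof.
by apply: le_ereal_inf_tmp => _ [al [be [_ ->]]]; rewrite lee_fin sqrtr_ge0.
Qed.

Lemma grushin_norm_ge_fst p v : (`|v.1|%:E <= grushin_norm p v)%E.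
Proof.
apply: le_ereal_inf_tmp => _ [al [be [-> ->]]]; rewrite grushin_combination lee_fin /= -sqrtr_sqr.
by rewrite ler_wsqrtr // lerDl sqr_ge0.
Qed.

(** On a vector [al X1 + be X2] the second coordinate is [be * p.1], and [|be|] is
    at most the norm. *)
Lemma grushin_norm_ge_snd p v (c : R) : 0 < c -> `|p.1| <= c ->
  ((c^-1 * `|v.2|)%:E <= grushin_norm p v)%E.
Proof.
move=> c0 pc; apply: le_ereal_inf_tmp => _ [al [be [-> ->]]].
rewrite grushin_combination lee_fin /= normrM ler_pdivrMl //.
rewrite mulrC; apply: ler_pM => //.
by rewrite -sqrtr_sqr ler_wsqrtr // lerDr sqr_ge0.
Qed.

Lemma grushin_norm_le p (al be : R) :
  (grushin_norm p (al, be * p.1)%R <= (`|al| + `|be|)%:E)%E.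
Proof.
apply: le_trans (_ : (Num.sqrt (al ^+ 2 + be ^+ 2))%:E <= _)%E.
  apply: ereal_inf_lbound; exists al, be; split => //.
  by rewrite grushin_combination.
rewrite lee_fin -[leRHS]ger0_norm ?addr_ge0 // -sqrtr_sqr ler_wsqrtr //.
rewrite sqrrD !real_normK ?num_real // lerD2r lerDl.
by rewrite mulrn_wge0 // mulr_ge0.
Qed.
End norm.

(** The first bound holds on every initial piece of the curve, so the first
    coordinate stays below [|(g a).1| + l]; this is the factor by which the speed
    of the second coordinate exceeds the Grushin norm. *)
Lemma horizontal_curve_bounds (R : realType) (a b l : R) (g : R -> R * R) :
  a < b -> 0 < l -> horizontal_curve a b g -> (grushin_length a b g <= l%:E)%E ->
  `|(g b).1 - (g a).1| <= l /\ `|(g b).2 - (g a).2| <= (`|(g a).1| + l) * l.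
Proof.
move=> ab l0 [acg aeg] gl; have [ac1 ac2] := ac_fst_snd acg.
have ae_sub (c : R) (P : R -> Prop) : c <= b ->
    (forall t, a < t < c -> derivable g t 1 -> P t) ->
    {ae lebesgue_measure, forall t : R, a < t < c -> P t}.
  move=> cb H; move: aeg; apply: filterS; first exact: (ae_filter_ringOfSetsType lebesgue_measure).
  move=> t Ht /andP[at_ tc]; apply: H; first by rewrite at_.
  by have [|] := Ht; first by rewrite at_ (lt_le_trans tc).
have hor c : a <= c <= b -> `|(g c).1 - (g a).1| <= l.
  move=> /andP[]; rewrite le_eqVlt => /predU1P[<- _|ac cb].
    by rewrite subrr normr0 ltW.
  rewrite -[leRHS]mul1r.
  apply: (@ac_increment_le_integral _ a c (fst \o g) ac (ac_subitv cb ac1)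
    (fun t => grushin_norm (g t) (g^`()%classic t))) => //.
  - by move=> t; exact: grushin_norm_ge0.
  - apply: ae_sub => // t _ dg; have [d1 E _ _] := derive1_fst_snd dg.
    by split => //; rewrite E invr1 mul1r grushin_norm_ge_fst.
  - apply: le_trans gl; rewrite /grushin_length integral_mkcond [leRHS]integral_mkcond.
    apply: ge0_le_integral_nonmeasurable => t _; rewrite /patch.
    have n0 := grushin_norm_ge0 (g t) (g^`()%classic t).
    case: ifPn => [|_]; last by case: ifP => //; rewrite lexx.
    rewrite inE /= in_itv /= => /andP[at_ tc].
    by rewrite mem_set /= ?n0 ?lexx // in_itv /= at_ (lt_le_trans tc).
split; first by apply: hor; rewrite lexx ltW.
have c0 : 0 < `|(g a).1| + l by rewrite ltr_wpDl.
apply: (@ac_increment_le_integral _ a b (snd \o g) ab ac2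
    (fun t => grushin_norm (g t) (g^`()%classic t))) => //.
- by move=> t; exact: grushin_norm_ge0.
- apply: ae_sub => // t /andP[at_ tb] dg; have [_ _ d2 E] := derive1_fst_snd dg.
  split => //; rewrite E grushin_norm_ge_snd //.
  have := hor t; rewrite (ltW at_) (ltW tb) => /(_ isT) H.
  rewrite -(subrK (g a).1 (g t).1) addrC; apply: le_trans (ler_normD _ _) _.
  by rewrite lerD2l.
Qed.

Section gauge.
Variable R : realType.
Implicit Types p q : R * R.

Definition grushin_scale p q : R :=
  Num.max (Num.sqrt `|p.2 - q.2|) (Num.max `|p.1| `|q.1|).

(** For [p = q] on the singular line the scale is 0 and the quotient is [0 / 0],
    whose value 0 is the right one. *)
Definition grushin_gauge p q : R :=
  `|p.1 - q.1| + `|p.2 - q.2| / grushin_scale p q.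

Lemma sqrt_snd_le_scale p q : Num.sqrt `|p.2 - q.2| <= grushin_scale p q.
Proof. by rewrite /grushin_scale le_max lexx. Qed.

Lemma fst_le_scale p q :
  `|p.1| <= grushin_scale p q /\ `|q.1| <= grushin_scale p q.
Proof. by rewrite /grushin_scale !le_max !lexx !orbT. Qed.

Lemma snd_le_scale_sqr p q : `|p.2 - q.2| <= grushin_scale p q ^+ 2.
Proof.
have D0 := normr_ge0 (p.2 - q.2); have XD := sqrt_snd_le_scale p q.
rewrite -[leLHS](sqr_sqrtr D0) ler_pXn2r ?nnegrE ?sqrtr_ge0 //.
exact: le_trans XD.
Qed.

Lemma scale_attained p q :
  [\/ grushin_scale p q ^+ 2 = `|p.2 - q.2|, grushin_scale p q = `|p.1| |
      grushin_scale p q = `|q.1|].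
Proof.
rewrite /grushin_scale; case: (leP (Num.sqrt `|p.2 - q.2|)) => _.
  by case: (leP `|p.1|) => _; [constructor 3|constructor 2].
by constructor 1; rewrite sqr_sqrtr.
Qed.

(** A curve of length [l] gives [D <= (X + l) l].  If [l <= X] this is at most
    [2 X l]; otherwise [D <= 2 l^2], so [sqrt D <= 2 l], and
    [D / X <= sqrt D]. *)
Lemma gauge_le_dist p q : ((grushin_gauge p q)%:E <= 3%:E * grushin_dist p q)%E.
Proof.
have key l : 0 < l -> (grushin_dist p q < l%:E)%E -> grushin_gauge p q <= 3 * l.
  move=> l0 /ereal_inf_lt[_ [a [b [g [ab hg <- <- ->]]]] /ltW gl].
  have [h1 h2] := horizontal_curve_bounds ab l0 hg gl.
  rewrite /grushin_gauge [`|_ - (g b).1|]distrC.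
  have : `|(g a).2 - (g b).2| / grushin_scale (g a) (g b) <= 2 * l.
    move: h2; rewrite distrC; set D := `|(g a).2 - _|; set X := grushin_scale _ _ => h2.
    have X1 : Num.sqrt D <= X by exact: sqrt_snd_le_scale.
    have [X2 _] : `|(g a).1| <= X /\ `|(g b).1| <= X by exact: fst_le_scale.
    have DE : D = Num.sqrt D ^+ 2 by rewrite sqr_sqrtr // normr_ge0.
    have X0 : 0 <= X by apply: le_trans X2.
    move: X0; rewrite le_eqVlt => /predU1P[<-|X0]; first by rewrite invr0 mulr0 mulr_ge0 // ltW.
    rewrite ler_pdivrMr //; have [lX|Xl] := leP l X.
      apply: (le_trans h2); rewrite [leRHS]mulrAC.
      by apply: ler_wpM2r; [exact: ltW|lra].
    have s0 := sqrtr_ge0 D.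
    rewrite [leLHS]DE expr2; apply: ler_pM => //.
    rewrite leNgt; apply/negP => sl; rewrite DE in h2.
    have : `|(g a).1| <= l by lra.
    have := normr_ge0 (g a).1; nra.
  lra.
have d0 : (0 <= grushin_dist p q)%E.
  apply: le_ereal_inf_tmp => _ [a [b [g [_ _ _ _ ->]]]].
  by apply: integral_ge0 => t _; exact: grushin_norm_ge0.
case E : (grushin_dist p q) d0 => [d| |] //= d0; last first.
  by rewrite mulry gtr0_sg // mul1e leey.
rewrite -EFinM lee_fin; apply/ler_addgt0Pr => e e0.
have := key (d + e / 3); rewrite E lte_fin; rewrite lee_fin in d0.
have : 0 < e / 3 by rewrite divr_gt0.
move=> e3 /(_ _ _)/le_trans; apply; lra.
Qed.
End gauge.

(** * Upper bound for the Grushin distance *)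

Lemma poly_lipschitz01 (R : realType) (p : {poly R}) : exists2 K : R, 0 < K &
  forall s t, 0 <= s <= 1 -> 0 <= t <= 1 -> `|p.[t] - p.[s]| <= K * `|t - s|.
Proof.
suff [K [M [K0 M0 H]]] : exists K M : R, [/\ 0 < K, 0 < M & forall s t,
    0 <= s <= 1 -> 0 <= t <= 1 -> `|p.[s]| <= M /\ `|p.[t] - p.[s]| <= K * `|t - s|].
  by exists K => // s t s01 t01; have [] := H s t s01 t01.
elim/poly_ind: p => [|p c [K [M [K0 M0 H]]]].
  by exists 1, 1; split => // s t _ _; rewrite !horner0 subrr normr0 mul1r; split.
exists (K + M), (M + `|c|); split; [exact: addr_gt0|exact: ltr_wpDr|].
move=> s t s01 t01; have [Ms Kst] := H s t s01 t01; rewrite !hornerE; split.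
  apply: le_trans (ler_normD _ _) _; rewrite lerD2r normrM.
  have : `|s| <= 1 by rewrite ger0_norm; lra.
  have := normr_ge0 p.[s]; have := normr_ge0 s; nra.
have -> : p.[t] * t + c - (p.[s] * s + c) = (p.[t] - p.[s]) * t + p.[s] * (t - s) by ring.
apply: le_trans (ler_normD _ _) _; rewrite !normrM mulrDl; apply: lerD; last first.
  exact: ler_wpM2r.
have : `|t| <= 1 by rewrite ger0_norm; lra.
have := normr_ge0 (p.[t] - p.[s]); have := normr_ge0 t; nra.
Qed.

Section upper.
Variable R : realType.
Implicit Types (P Q : {poly R}) (p q : R * R).

Lemma poly_curve_ac P Q : absolutely_continuous 0 1 (fun t => (P.[t], Q.[t])).
Proof.
have [K K0 HK] := poly_lipschitz01 P; have [L L0 HL] := poly_lipschitz01 Q.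
have KL : 0 < K + L by exact: addr_gt0.
move=> e e0; exists (e / (K + L)); first exact: divr_gt0.
move=> n s t st _; rewrite ltr_pdivlMr // mulrC mulr_sumr; apply: le_lt_trans.
apply: ler_sum => i _; have [s0 ts t1] := st i.
rewrite -[X in _ <= _ * X]ger0_norm ?subr_ge0 // prod_normE /= ge_max mulrDl.
have s01 : 0 <= s i <= 1 by rewrite s0 (le_trans ts t1).
have t01 : 0 <= t i <= 1 by rewrite t1 (le_trans s0 ts).
by rewrite ler_wpDr ?ler_wpDl ?HK ?HL // mulr_ge0 // ltW.
Qed.

Lemma poly_curve_derive P Q (t : R) :
  derivable (fun t => (P.[t], Q.[t])) t 1 /\
  (fun t => (P.[t], Q.[t]))^`()%classic t = (P^`().[t], Q^`().[t]).
Proof.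
have dP (S : {poly R}) :
    (h^-1 *: (S.[h *: 1 + t] - S.[t])) @[h --> 0^'] --> S^`().[t].
  have [dS <-] := is_derive_poly S t; exact: dS.
have c : (h^-1 *: ((P.[h *: 1 + t], Q.[h *: 1 + t]) - (P.[t], Q.[t]))) @[h --> 0^']
     --> (P^`().[t], Q^`().[t]) by apply: (cvg_pair (dP P) (dP Q)).
split; first by apply: cvgP; exact: c.
by rewrite derive1E; apply: cvg_lim => //; exact: c.
Qed.

(** If [Q' = be P], then the velocity of the curve [(P, Q)] is
    [P' X1 + be X2] at every point. *)
Lemma grushin_dist_le_poly P Q (be l : R) : Q^`() = be *: P ->
  (forall t, 0 <= t <= 1 -> `|P^`().[t]| + `|be| <= l) ->
  (grushin_dist (P.[0], Q.[0]) (P.[1], Q.[1]) <= l%:E)%E.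
Proof.
move=> dQ dP; pose g t := (P.[t], Q.[t]).
have gE t : g^`()%classic t = (P^`().[t], be * (g t).1).
  by have [_ ->] := poly_curve_derive P Q t; rewrite dQ hornerZ.
apply: le_trans (_ : grushin_length 0 1 g <= _)%E.
  apply: ereal_inf_lbound; exists 0, 1, g; split => //.
  split; first exact: poly_curve_ac.
  apply: aeW => t _; have [dg _] := poly_curve_derive P Q t; split => //.
  by exists P^`().[t], be; rewrite grushin_combination gE.
apply: (@le_trans _ _ (\int[lebesgue_measure]_(t in [set` `]0%R, 1%R[]) (cst l%:E t))%E).
  apply: ge0_le_integral_nonmeasurable => t /=; rewrite in_itv /= => /andP[t0 t1].
  rewrite grushin_norm_ge0 /= gE; apply: le_trans (grushin_norm_le _ _ _) _.
  by rewrite lee_fin dP // !ltW.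
rewrite integral_cst //= lebesgue_measure_itv /= lte_fin ltr01 -EFinB subr0 mule1.
by rewrite lexx.
Qed.

(** The first coordinate is [x + t (x' - x) + s t (1 - t)], whose mean over [[0, 1]]
    is [(x + x') / 2 + s / 6]; the second is its primitive times [be], so that
    the hypothesis says that the curve ends at height [q.2]. *)
Lemma grushin_dist_le p q (s be : R) :
  be * ((p.1 + q.1) / 2 + s / 6) = q.2 - p.2 ->
  (grushin_dist p q <= (`|q.1 - p.1| + `|s| + `|be|)%:E)%E.
Proof.
case: p q => [x y] [x' y'] /= E; pose dx := x' - x.
pose P := x%:P + (dx + s) *: 'X - s *: 'X^2.
pose Q := y%:P + (be * x) *: 'X + (be * (dx + s) / 2) *: 'X^2 - (be * s / 3) *: 'X^3.
have := @grushin_dist_le_poly P Q be (`|dx| + `|s| + `|be|).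
have -> : (P.[0], Q.[0]) = (x, y).
  by rewrite /P /Q !hornerE /= !(mulr0, mul0r, expr0n, subr0, addr0).
have -> : (P.[1], Q.[1]) = (x', y').
  rewrite /P /Q !hornerE /= ?expr1n; congr pair; first by rewrite /dx; ring.
  by rewrite -(subrK y y') -E /dx; field.
apply.
  rewrite /P /Q !poly.derivE /= !scalerDr !scalerN !scalerA.
  apply/polyP => i; rewrite !coefE /=.
  by case: i => [|[|[|i]]] //=; rewrite !(mulr0, mulr1, addr0, add0r, subr0, mul0rn, mulr1n); field.
move=> t /andP[t0 t1]; rewrite lerD2r.
have -> : P^`().[t] = dx + s * (1 - 2 * t).
  by rewrite /P !poly.derivE !hornerE /=; ring.
apply: le_trans (ler_normD _ _) _; rewrite lerD2l normrM ler_piMr //.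
by rewrite ler_norml; lra.
Qed.

(** The bending parameter [s] has the sign of [x + x'] and size [6 D / X], so the mean
    [m] of the first coordinate satisfies [|m| = |x + x'| / 2 + D / X], and it
    remains to bound the vertical coefficient [D / |m|].  If [X^2 = D] the summand
    [D / X = X] of [|m|] suffices.  Otherwise [X] is [|x|] or [|x'|], and either
    [|x + x'|] is comparable to [X] or [|x - x'|] exceeds [X >= D / |m|]. *)
Lemma dist_le_gauge p q : (grushin_dist p q <= (8 * grushin_gauge p q)%:E)%E.
Proof.
pose D := `|p.2 - q.2|; pose X := grushin_scale p q; pose e := D / X.
have D0 : 0 <= D := normr_ge0 _.
have XD : Num.sqrt D <= X by exact: sqrt_snd_le_scale.
have [Xp Xq] : `|p.1| <= X /\ `|q.1| <= X by exact: fst_le_scale.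
have X0 : 0 <= X by apply: le_trans Xp.
have e0 : 0 <= e by rewrite divr_ge0.
pose s := if 0 <= p.1 + q.1 then 6 * e else - (6 * e).
pose m := (p.1 + q.1) / 2 + s / 6.
have mE : `|m| = `|p.1 + q.1| / 2 + e.
  rewrite /m /s; case: ifPn => pq.
    by rewrite !ger0_norm //; [field|apply: addr_ge0; [rewrite divr_ge0|lra]].
  rewrite -ltNge in pq; rewrite !ltr0_norm //; [field|]; lra.
have sE : `|s| = 6 * e by rewrite /s; case: ifP => _; rewrite ?normrN ger0_norm // mulr_ge0.
have [D0'|Dn] := eqVneq D 0.
  have y0 : p.2 = q.2 by apply/eqP; rewrite -subr_eq0 -normr_eq0 -/D D0'.
  apply: le_trans (@grushin_dist_le p q s 0 _) _.
    by rewrite mul0r y0 subrr.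
  rewrite lee_fin sE normr0 /grushin_gauge -/D -/X -/e distrC.
  have := normr_ge0 (p.1 - q.1); lra.
have DX : 0 < X.
  by apply: lt_le_trans XD; rewrite sqrtr_gt0 lt_neqAle eq_sym Dn.
have eX : e * X = D by rewrite /e divfK // lt0r_neq0.
have e1 : 0 < e by rewrite divr_gt0 // lt_neqAle eq_sym Dn.
have m0 : 0 < `|m| by rewrite mE; apply: ltr_wpDl => //; rewrite divr_ge0.
apply: le_trans (@grushin_dist_le p q s ((q.2 - p.2) / m) _) _.
  by rewrite -/m divfK // -normr_gt0.
rewrite lee_fin sE /grushin_gauge -/D -/X -/e distrC.
suff : `|(q.2 - p.2) / m| <= `|p.1 - q.1| + 2 * e.
  have := normr_ge0 (p.1 - q.1); lra.
rewrite normrM normfV distrC -/D ler_pdivrMr // mE.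
have d0 := normr_ge0 (p.1 - q.1).
have [XS|XM] : X ^+ 2 = D \/ 2 * X <= `|p.1 + q.1| + `|p.1 - q.1|.
  have [XE|XE|XE] := scale_attained p q; rewrite -/X in XE; [by left|right|right].
  - rewrite XE (_ : 2 * `|p.1| = `|2 * p.1|); last by rewrite normrM ger0_norm.
    have -> : 2 * p.1 = (p.1 + q.1) + (p.1 - q.1) by ring.
    exact: ler_normD.
  - rewrite XE (_ : 2 * `|q.1| = `|2 * q.1|); last by rewrite normrM ger0_norm.
    have -> : 2 * q.1 = (p.1 + q.1) - (p.1 - q.1) by ring.
    exact: ler_normB.
- have : e * e = D by move: XS; rewrite -eX expr2 => /(mulIf (lt0r_neq0 DX)) ->.
  have := normr_ge0 (p.1 + q.1); nra.
rewrite -eX; move: (`|p.1 - q.1|) (`|p.1 + q.1|) d0 (normr_ge0 (p.1 + q.1)) XM => d S d0 S0 XM.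
have dS := mulr_ge0 d0 S0; have de := mulr_ge0 d0 e0; have ee := mulr_ge0 e0 e0.
have [dX|Xd] := leP d X.
  have : 0 <= e * (S - X) by apply: mulr_ge0 => //; lra.
  lra.
have : 0 <= e * (d - X) by apply: mulr_ge0 => //; lra.
have := mulr_ge0 e0 S0; lra.
Qed.
End upper.

(** * The periodic waves *)

Lemma lipschitz_of_derive (R : realType) (f df : R -> R) :
  (forall x : R, is_derive x 1 f (df x)) -> (forall x, `|df x| <= 1) ->
  forall a b, `|f a - f b| <= `|a - b|.
Proof.
move=> fd df1 a b; wlog ab : a b / a <= b.
  move=> W; have [|/ltW] := leP a b; first exact: W.
  by move=> ba; rewrite distrC [leRHS]distrC; exact: W.
have fc x : {for x, continuous f}.
  by apply: differentiable_continuous; apply/derivable1_diffP; have [] := fd x.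
have [c _ E] := MVT_segment ab (fun x _ => fd x) (continuous_subspaceT fc).
by rewrite distrC E normrM distrC ler_piMl.
Qed.

Section wave.
Variable R : realType.

(** The value 0 at 0 makes the levels of large scale summable, and the bound makes
    those of small scale summable. *)
Definition wave (psi : R -> R) : Prop :=
  [/\ psi 0 = 0, forall a b, `|psi a - psi b| <= `|a - b| & forall a, `|psi a| <= 2].

Lemma sin_wave : wave sin.
Proof.
split; first exact: sin0; last first.
  by move=> a; rewrite ler_norml; have := sin_le1 a; have := sin_geN1 a; lra.
apply: lipschitz_of_derive => x.
by rewrite ler_norml cos_le1 cos_geN1.
Qed.

Lemma cos_lipschitz (a b : R) : `|cos a - cos b| <= `|a - b|.
Proof.
apply: lipschitz_of_derive => x.
by rewrite normrN ler_norml sin_le1 sin_geN1.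
Qed.

Lemma cos_wave : wave (fun a => cos a - 1).
Proof.
split; first by rewrite cos0 subrr.
- move=> a b; rewrite (_ : _ - _ = cos a - cos b); last by ring.
  exact: cos_lipschitz.
- by move=> a; rewrite ler_norml; have := cos_le1 a; have := cos_geN1 a; lra.
Qed.

Lemma sin_ge_half (v : R) : 0 <= v <= 1 / 2 -> v / 2 <= sin v.
Proof.
move=> /andP[v0 v1]; have sc x : {for x, continuous (@sin R)} by exact: continuous_sin.
have [c] := MVT_segment v0 (fun x _ => is_derive_sin x) (continuous_subspaceT sc).
rewrite in_itv /= sin0 !subr0 => /andP[c0 cv] ->; rewrite mulrC.
apply: ler_wpM2r => //; have := cos_lipschitz 0 c; rewrite cos0 sub0r normrN.
by rewrite [leRHS]ger0_norm // ler_norml; lra.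
Qed.

(** The chord of the unit circle between the angles [a] and [b] is comparable to
    [|a - b|], so one of its two coordinates is. *)
Lemma sin_cos_separate (a b : R) : `|a - b| <= 1 ->
  `|a - b| / 3 <= `|sin a - sin b| \/
  `|a - b| / 3 <= `|(cos a - 1) - (cos b - 1)|.
Proof.
move=> ab1; rewrite (_ : cos a - 1 - (cos b - 1) = cos a - cos b); last by ring.
set u := `|a - b| in ab1 *; have u0 : 0 <= u by exact: normr_ge0.
have : u ^+ 2 / 4 <= `|sin a - sin b| ^+ 2 + `|cos a - cos b| ^+ 2.
  rewrite [`|sin a - _| ^+ 2]real_normK ?num_real // [`|cos a - _| ^+ 2]real_normK ?num_real //.
  have -> : (sin a - sin b) ^+ 2 + (cos a - cos b) ^+ 2 = 2 * (1 - cos (a - b)).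
    rewrite cosB; have := cos2Dsin2 a; have := cos2Dsin2 b; lra.
  have -> : cos (a - b) = 1 - 2 * sin (u / 2) ^+ 2.
    have -> : cos (a - b) = cos (u / 2 + u / 2).
      by rewrite -splitr /u; case: (ger0P (a - b)) => // _; rewrite cosN.
    rewrite cosD; have := cos2Dsin2 (u / 2); rewrite !expr2; lra.
  have : u / 2 / 2 <= sin (u / 2) by apply: sin_ge_half; lra.
  move: (sin (u / 2)) => v uv.
  have : 0 <= (v - u / 4) * (v + u / 4) by apply: mulr_ge0; lra.
  rewrite !expr2; lra.
have := normr_ge0 (sin a - sin b); have := normr_ge0 (cos a - cos b).
move: (`|sin a - sin b|) (`|cos a - cos b|) => x y y0 x0 H.
have [|xu] := leP (u / 3) x; first by left.
right; rewrite leNgt; apply/negP => yu; nra.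
Qed.
End wave.

(** * One level, and sums over geometric scales *)

Section levels.
Variable R : realType.
Implicit Types (s x : R) (p q : R * R) (psi : R -> R).

(** Equal to [s] near the singular line and to [0] beyond [2 s].  Written with minima,
    the increment between [u] and [v] becomes [m (2 s) - m s] for a single
    nondecreasing function [m], which telescopes over geometric scales. *)
Definition cutoff s x : R := s - Num.min `|x| (2 * s) + Num.min `|x| s.

Lemma cutoff_inner s x : 0 < s -> `|x| <= s -> cutoff s x = s.
Proof. by move=> s0 xs; rewrite /cutoff !min_l //; lra. Qed.

Lemma cutoff_outer s x : 0 < s -> 2 * s <= `|x| -> cutoff s x = 0.
Proof. by move=> s0 xs; rewrite /cutoff !min_r //; lra. Qed.

Lemma cutoff_ge0 s x : 0 < s -> 0 <= cutoff s x.
Proof. by move=> s0; rewrite /cutoff /Num.min; case: ifPn; case: ifPn; do ?rewrite -leNgt; lra. Qed.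

Lemma cutoff_le s x : 0 < s -> cutoff s x <= s.
Proof.
by move=> s0; rewrite /cutoff /Num.min; case: ifPn; case: ifPn; do ?rewrite -leNgt; lra.
Qed.

Definition level psi s p : R := cutoff s p.1 * psi (p.2 / s ^+ 2).

Lemma level_le psi s p : wave psi -> 0 < s -> `|level psi s p| <= 2 * s.
Proof.
move=> [_ _ psi2] s0; rewrite /level normrM mulrC.
by apply: ler_pM => //; rewrite ger0_norm ?cutoff_ge0 ?cutoff_le.
Qed.

Lemma wave_increment psi s (y y' : R) : wave psi -> 0 < s ->
  s * `|psi (y / s ^+ 2) - psi (y' / s ^+ 2)| <= `|y - y'| / s.
Proof.
move=> [_ lip _] s0; rewrite mulrC -ler_pdivlMr //; apply: le_trans (lip _ _) _.
rewrite -mulrBl normrM [X in _ * X]gtr0_norm ?invr_gt0 ?exprn_gt0 //.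
by rewrite expr2 invfM mulrA.
Qed.

Lemma level_le_snd psi s p : wave psi -> 0 < s -> `|level psi s p| <= `|p.2| / s.
Proof.
move=> wp s0; have := wave_increment p.2 0 wp s0; have [psi0 _ _] := wp.
rewrite mul0r psi0 !subr0; apply: le_trans.
by rewrite /level normrM ler_wpM2r // ger0_norm ?cutoff_ge0 ?cutoff_le.
Qed.

Lemma level_increment_le psi s p q : wave psi -> 0 < s ->
  `|level psi s p - level psi s q| <=
  2 * `|cutoff s p.1 - cutoff s q.1| +
  cutoff s q.1 * `|psi (p.2 / s ^+ 2) - psi (q.2 / s ^+ 2)|.
Proof.
move=> [_ _ psi2] s0; rewrite /level.
set h := cutoff s p.1; set k := cutoff s q.1; set u := psi _; set v := psi _.
have -> : h * u - k * v = (h - k) * u + k * (u - v) by ring.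
apply: le_trans (ler_normD _ _) _; rewrite !normrM [X in _ + X * _]ger0_norm ?cutoff_ge0 //.
by rewrite lerD2r mulrC ler_wpM2r // psi2.
Qed.

Lemma sum_telescope_le (a b : nat -> R) (m n : nat) : (m <= n)%N ->
  (forall i, a i <= b i.+1 - b i) ->
  \sum_(m <= i < n) a i <= b n - b m.
Proof.
by move=> mn H; rewrite -telescope_sumr //; apply: ler_sum => i _; exact: H.
Qed.

Variables (t : R) (t0 : 0 < t).
Let s_ i := t * 64 ^+ i.
Let s_gt0 i : 0 < s_ i. Proof. by rewrite mulr_gt0 // exprn_gt0. Qed.
Let s_S i : s_ i.+1 = 64 * s_ i. Proof. by rewrite /s_ exprS; ring. Qed.

(** For [m c = min |v| c - min |u| c], nondecreasing and bounded by [|u - v|], the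
    terms are [m (2 s_i) - m (s_i) <= m (s_{i+1}) - m (s_i)]. *)
Lemma cutoff_variation (u v : R) n : `|u| <= `|v| ->
  \sum_(0 <= i < n) `|cutoff (s_ i) u - cutoff (s_ i) v| <= `|u - v|.
Proof.
move=> uv; pose m (c : R) := Num.min `|v| c - Num.min `|u| c.
have m_le c d : c <= d -> m c <= m d.
  by rewrite /m /Num.min; repeat case: ifPn; do ?rewrite -leNgt; lra.
apply: le_trans (_ : m (s_ n) - m (s_ 0%N) <= _); last first.
  have := lerB_dist v u; rewrite distrC /m /Num.min.
  by have := s_gt0 0; have := s_gt0 n; repeat case: ifPn; do ?rewrite -leNgt; lra.
apply: (@sum_telescope_le _ (fun i => m (s_ i))) => // i.
have -> : cutoff (s_ i) u - cutoff (s_ i) v = m (2 * s_ i) - m (s_ i).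
  by rewrite /cutoff /m; ring.
have := s_gt0 i => si; rewrite ger0_norm ?subr_ge0; last by apply: m_le; lra.
by rewrite lerD2r; apply: m_le; rewrite s_S; lra.
Qed.

(** A term is at most [D / s] and at most [4 s], and vanishes when [2 s <= |q.1|]; in all
    cases it is at most a multiple of [(D / X) min (s / X) (X / s)].  The increment
    of [s / (s + X)] from [s] to [64 s] is comparable to this minimum and
    telescopes. *)
Lemma vertical_term psi p q i (X := grushin_scale p q) :
  wave psi -> `|p.1| <= `|q.1| -> 0 < X ->
  cutoff (s_ i) q.1 * `|psi (p.2 / s_ i ^+ 2) - psi (q.2 / s_ i ^+ 2)| <=
  9 * (`|p.2 - q.2| / X) * (s_ i.+1 / (s_ i.+1 + X) - s_ i / (s_ i + X)).
Proof.
move=> wp pq X0; set D := `|p.2 - q.2|.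
have D0 : 0 <= D by exact: normr_ge0.
have s0 := s_gt0 i; rewrite s_S; set s := s_ i in s0 *.
have -> : 64 * s / (64 * s + X) - s / (s + X) = 63 * X * s / ((s + X) * (64 * s + X)).
  by field; rewrite !lt0r_neq0 //; apply: addr_gt0; lra.
have -> : 9 * (D / X) * (63 * X * s / ((s + X) * (64 * s + X))) =
    567 * D * s / ((s + X) * (64 * s + X)).
  by field; rewrite !lt0r_neq0 //; apply: addr_gt0; lra.
have P0 : 0 < (s + X) * (64 * s + X) by apply: mulr_gt0; lra.
rewrite ler_pdivlMr //.
set w := `|psi _ - psi _|; have w0 : 0 <= w by exact: normr_ge0.
have [Ms|sM] := leP (2 * s) `|q.1|.
  by rewrite cutoff_outer // !mul0r; apply: mulr_ge0; [nra|lra].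
have cs : cutoff s q.1 * w <= s * w by rewrite ler_wpM2r // cutoff_le.
have ws : s * w <= D / s := wave_increment _ _ wp s0.
have w4 : w <= 4.
  have [_ _ psi2] := wp; have := psi2 (p.2 / s ^+ 2); have := psi2 (q.2 / s ^+ 2).
  have := ler_normB (psi (p.2 / s ^+ 2)) (psi (q.2 / s ^+ 2)); rewrite -/w; lra.
have XD : D <= X ^+ 2 by exact: snd_le_scale_sqr.
apply: (@le_trans _ _ (s * w * ((s + X) * (64 * s + X)))).
  by rewrite ler_wpM2r // ltW.
have [Xs|sX] := leP X (2 * s).
  apply: (@le_trans _ _ (D / s * ((s + X) * (64 * s + X)))).
    by rewrite ler_wpM2r // ltW.
  have -> : 567 * D * s = D * (567 * s) by ring.
  rewrite -mulrA; apply: ler_wpM2l => //; rewrite ler_pdivrMl //.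
  have -> : s * (567 * s) = 3 * s * (189 * s) by ring.
  by apply: ler_pM; lra.
have DX : D = X ^+ 2.
  have [->//|XE|XE] := scale_attained p q; rewrite -/X in XE; lra.
apply: (@le_trans _ _ (s * 4 * ((s + X) * (64 * s + X)))).
  by rewrite ler_wpM2r ?ler_wpM2l // ltW.
have -> : 567 * D * s = s * (567 * (X * X)) by rewrite DX; ring.
rewrite -mulrA; apply: ler_wpM2l; first exact: ltW.
have : (s + X) * (64 * s + X) <= (2 * X) * (65 * X) by apply: ler_pM; lra.
have := mulr_ge0 (ltW X0) (ltW X0); lra.
Qed.

(** An increment splits into the part due to the cutoffs, summed by
    [cutoff_variation], and the part due to the wave, summed by
    [vertical_term].  Choosing [q] farther from the singular line than [p]
    makes [cutoff (s_ i) q.1] the smaller of the two cutoffs. *)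
Lemma level_sum_increment_le psi p q n : wave psi ->
  `|\sum_(0 <= i < n) (level psi (s_ i) p - level psi (s_ i) q)| <= 9 * grushin_gauge p q.
Proof.
move=> wp; wlog pq : p q / `|p.1| <= `|q.1|.
  move=> W; have [|/ltW] := leP `|p.1| `|q.1|; first exact: W.
  move=> qp; have := W q p qp; rewrite -normrN -sumrN.
  under eq_bigr do rewrite opprB; move/le_trans; apply.
  by rewrite /grushin_gauge /grushin_scale [`|q.2 - _|]distrC [`|q.1 - _|]distrC maxC [Num.max `|q.1| _]maxC maxC.
apply: le_trans (ler_norm_sum _ _ _) _.
apply: (@le_trans _ _ (\sum_(0 <= i < n) (2 * `|cutoff (s_ i) p.1 - cutoff (s_ i) q.1| +
  cutoff (s_ i) q.1 * `|psi (p.2 / s_ i ^+ 2) - psi (q.2 / s_ i ^+ 2)|))).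
  by apply: ler_sum => i _; exact: level_increment_le.
rewrite big_split /= -mulr_sumr /grushin_gauge mulrDr; apply: lerD.
  have := cutoff_variation n pq; have := normr_ge0 (p.1 - q.1); lra.
have [pq2|pq2] := eqVneq p.2 q.2.
  rewrite big1 => [|i _]; last by rewrite pq2 subrr normr0 mulr0.
  by rewrite pq2 subrr normr0 mul0r mulr0.
have X0 : 0 < grushin_scale p q.
  by rewrite /grushin_scale lt_max sqrtr_gt0 normr_gt0 subr_eq0 pq2.
set X := grushin_scale p q in X0 *.
apply: (le_trans (@sum_telescope_le _
   (fun i => 9 * (`|p.2 - q.2| / X) * (s_ i / (s_ i + X))) 0 n _ _)) => //.
  by move=> i; rewrite -mulrBr; exact: vertical_term.
rewrite -mulrBr ler_piMr //.
  by rewrite mulr_ge0 // divr_ge0 // ltW.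
have sX i : 0 < s_ i + X by exact: addr_gt0.
have : s_ n / (s_ n + X) <= 1 by rewrite ler_pdivrMr // mul1r lerDl ltW.
have : 0 <= s_ 0 / (s_ 0 + X) by rewrite divr_ge0 // ltW.
lra.
Qed.

(** Larger levels [s_i] change by at most [D / s_i], a geometric series with sum
    [D / (63 s)].  For the smaller ones there are two cases.  If [X^2 = D] they
    change by at most [4 s_i], in total at most [4 s / 63 <= 16 / 63 * (D / s)], as
    [s <= 2 X].  Otherwise one of [|x|], [|x'|] equals [X >= s / 2] and
    [|x - x'| < s / 4], hence both are at least [s / 4 >= 2 s_i], and the smaller
    levels vanish at both points. *)
Lemma level_sum_increment_ge psi p q n k (X := grushin_scale p q) (s := s_ k) :
  wave psi -> (k < n)%N -> 0 < X -> X <= s -> s <= 2 * X -> `|p.1 - q.1| < `|p.2 - q.2| / (4 * s) ->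
  s * `|psi (p.2 / s ^+ 2) - psi (q.2 / s ^+ 2)| <=
  `|\sum_(0 <= i < n) (level psi (s_ i) p - level psi (s_ i) q)| +
    17 / 63 * (`|p.2 - q.2| / s).
Proof.
move=> wp kn X0 Xs sX xD; set D := `|p.2 - q.2| in xD *.
have D0 : 0 <= D by exact: normr_ge0.
have s0 : 0 < s := s_gt0 k.
have [pX qX] : `|p.1| <= X /\ `|q.1| <= X by exact: fst_le_scale.
have XD : D <= X ^+ 2 by exact: snd_le_scale_sqr.
have s_le i j : (i <= j)%N -> s_ i <= s_ j.
  by move=> ij; apply: ler_wpM2l; [exact: ltW|apply: ler_weXn2l => //; lra].
pose d i := level psi (s_ i) p - level psi (s_ i) q.
have dE i : (k <= i)%N ->
    `|d i| = s_ i * `|psi (p.2 / s_ i ^+ 2) - psi (q.2 / s_ i ^+ 2)|.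
  move=> ki; have ss := s_le _ _ ki; rewrite /d /level !cutoff_inner //; try by rewrite -/s in ss; lra.
  by rewrite -mulrBr normrM gtr0_norm.
have large : \sum_(k.+1 <= i < n) `|d i| <= 1 / 63 * (D / s).
  apply: (@le_trans _ _ (\sum_(k.+1 <= i < n) D / s_ i)).
    rewrite big_nat_cond [leRHS]big_nat_cond; apply: ler_sum => i /andP[/andP[ki _] _].
    by rewrite dE 1?ltnW //; exact: wave_increment.
  apply: (le_trans (@sum_telescope_le _ (fun i => - (64 / 63 * (D / s_ i))) k.+1 n kn _)).
    move=> i; rewrite s_S le_eqVlt; apply/orP; left; apply/eqP.
    by field; rewrite lt0r_neq0.
  have : 0 <= D / s_ n by rewrite divr_ge0 // ltW.
  have -> : D / s_ k.+1 = D / s / 64 by rewrite s_S -/s; field; rewrite lt0r_neq0.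
  lra.
have small : \sum_(0 <= i < k) `|d i| <= 16 / 63 * (D / s).
  have si i : (i < k)%N -> s_ i <= s / 64.
    by move=> ik; have := s_le _ _ ik; rewrite s_S -/s; lra.
  have [DX|XM] : X ^+ 2 = D \/ (X <= `|p.1| \/ X <= `|q.1|).
    by have [XE|XE|XE] := scale_attained p q; rewrite -/X in XE;
      [left|right; left|right; right]; rewrite ?XE.
    apply: (@le_trans _ _ (\sum_(0 <= i < k) 4 * s_ i)).
      apply: ler_sum => i _; apply: le_trans (ler_normB _ _) _.
      have := level_le p wp (s_gt0 i); have := level_le q wp (s_gt0 i); lra.
    apply: (le_trans (@sum_telescope_le _ (fun i => 4 / 63 * s_ i) 0 k _ _)) => //.
      by move=> i; rewrite s_S; lra.
    have := s_gt0 0; rewrite -/s.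
    have : s / 4 <= D / s by rewrite ler_pdivlMr //; nra.
    lra.
  have xs : `|p.1 - q.1| < s / 4.
    apply: (lt_le_trans xD); rewrite ler_pdivrMr ?mulr_gt0 //; nra.
  have := lerB_dist p.1 q.1; have := lerB_dist q.1 p.1; rewrite [`|q.1 - _|]distrC => h1 h2.
  have R0 : 0 <= 16 / 63 * (D / s) by apply: mulr_ge0; [lra|rewrite divr_ge0 // ltW].
  rewrite big_nat_cond big1 // => i /andP[/andP[_ ik] _].
  have := si i ik => si'; rewrite /d /level !cutoff_outer ?mul0r ?subrr ?normr0 //.
    by case: XM; lra.
  by case: XM; lra.
rewrite -dE // (@big_cat_nat _ _ _ k) //=; last exact: ltnW.
rewrite (big_ltn kn) -/(d k).
set S1 := \sum_(0 <= i < k) _; set S2 := \sum_(k.+1 <= i < n) _.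
have h1 : `|S1| <= \sum_(0 <= i < k) `|d i| by exact: ler_norm_sum.
have h2 : `|S2| <= \sum_(k.+1 <= i < n) `|d i| by exact: ler_norm_sum.
have -> : d k = (S1 + (d k + S2)) - S1 - S2 by ring.
have := ler_normB (S1 + (d k + S2) - S1) S2.
have := ler_normB (S1 + (d k + S2)) S1.
have -> : S1 + (S1 + (d k + S2) - S1 - S2 + S2) = S1 + (d k + S2) by ring.
lra.
Qed.
End levels.

(** * The embedding *)

Section embedding.
Variable R : realType.
Implicit Types (p q : R * R) (psi : R -> R) (r K : nat).

(** The symmetric window [-K <= n < K] of the scales [2^r 64^n] starts here; indexing it
    by natural numbers makes the lemmas on geometric scales applicable. *)
Definition coarsest r K : R := 2 ^+ r / 64 ^+ K.

Lemma coarsest_gt0 r K : 0 < coarsest r K.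
Proof. by rewrite divr_gt0 // exprn_gt0. Qed.

(** The interval [[X, 2 X]] contains a power of 2 with integer exponent [6 n + r], and
    every window that is wide enough contains the scale [2^r 64^n]. *)
Lemma dyadic_scale (X : R) : 0 < X -> exists r K0 s,
  [/\ (r < 6)%N, X <= s, s <= 2 * X & forall K, (K0 <= K)%N ->
    exists2 i, (i < K.*2)%N & coarsest r K * 64 ^+ i = s].
Proof.
move=> X0; pose n := Num.Def.archi_bound X^-1.
have p64 k : 0 < (64 : R) ^+ k by exact: exprn_gt0.
have Y1 : 1 <= X * 64 ^+ n.
  rewrite -ler_pdivrMl // mulr1; apply/ltW.
  apply: (lt_le_trans (@upper_nthrootP _ X^-1 n (leqnn _))).
  by apply: lerXn2r; rewrite ?nnegrE //; lra.
have exm : exists m, X * 64 ^+ n <= 2 ^+ m.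
  by exists (Num.Def.archi_bound (X * 64 ^+ n)); apply/ltW/upper_nthrootP.
case: (ex_minnP exm) => m Ym minm.
have mY : 2 ^+ m <= 2 * (X * 64 ^+ n).
  case: m Ym minm => [_ _|m Ym minm]; first by rewrite expr0; lra.
  rewrite exprS ler_pM2l // leNgt; apply/negP => /ltW /minm.
  by rewrite ltnn.
exists (m %% 6)%N, (n + m %/ 6).+1, (2 ^+ m / 64 ^+ n); split.
- exact: ltn_mod.
- by rewrite ler_pdivlMr.
- by rewrite ler_pdivrMr // -mulrA.
move=> K nK; have nK' : (n <= K)%N by apply: leq_trans nK; rewrite leqW // leq_addr.
exists (K - n + m %/ 6)%N.
  rewrite -addnn; apply: (leq_ltn_trans (leq_add (leq_subr n K) (leqnn _))).
  by rewrite ltn_add2l; apply: leq_trans nK; rewrite ltnS leq_addl.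
rewrite /coarsest exprD -[in 64 ^+ K](subnK nK') exprD [in RHS](divn_eq m 6) exprD mulnC exprM.
have -> : (2 : R) ^+ 6 = 64 by rewrite -natrX.
by field; rewrite !lt0r_neq0.
Qed.

Definition truncation psi r K p : R :=
  \sum_(0 <= i < K.*2) level psi (coarsest r K * 64 ^+ i) p.

Lemma truncationS psi r K p : truncation psi r K.+1 p =
  truncation psi r K p +
  (level psi (coarsest r K.+1) p + level psi (2 ^+ r * 64 ^+ K) p).
Proof.
have p64 k : (64 : R) ^+ k != 0 by rewrite lt0r_neq0 // exprn_gt0.
rewrite /truncation doubleS big_nat_recr //= big_nat_recl //= expr0 mulr1.
rewrite addrAC addrC; congr (_ + (_ + _)).
  apply: eq_bigr => i _; congr (level psi _ p).
  by rewrite /coarsest !exprS; field; rewrite p64.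
congr (level psi _ p).
by rewrite /coarsest -addnn !exprS exprD; field; rewrite p64.
Qed.

(** Widening the window adds a level of scale [2^r / 64^(K+1)], at most twice its
    scale, and one of scale [2^r 64^K], at most [|p.2|] divided by its scale. *)
Lemma truncation_cvg psi r p : wave psi -> cvgn (truncation psi r ^~ p).
Proof.
move=> wp; pose u := truncation psi r ^~ p.
have -> : truncation psi r ^~ p = (fun n => u 0%N + series (telescope u) n).
  by apply/funext => n; exact: (eq_sum_telescope u n).
apply: is_cvgD; first exact: is_cvg_cst.
apply: normed_cvg.
pose C := 2 * 2 ^+ r + `|p.2|.
apply: (@series_le_cvg _ _ (geometric C (64^-1))).
- by move=> n; exact: normr_ge0.
- by move=> n; rewrite /= mulr_ge0 // addr_ge0 // mulr_ge0 // exprn_ge0.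
- move=> n; rewrite /= /telescope /u /= truncationS addrC addKr.
  have p64 k : 0 < (64 : R) ^+ k by exact: exprn_gt0.
  have h1 := level_le p wp (coarsest_gt0 r n.+1).
  have s0 : 0 < (2 : R) ^+ r * 64 ^+ n by rewrite mulr_gt0 // exprn_gt0.
  have h2 := level_le_snd p wp s0.
  apply: le_trans (ler_normD _ _) _; rewrite mulrDl; apply: lerD.
    apply: (le_trans h1); rewrite /coarsest exprVn -mulrA ler_wpM2l // ler_wpM2l ?exprn_ge0 //.
    by rewrite lef_pV2 ?posrE // exprS ler_peMl ?ltW //; lra.
  apply: (le_trans h2); rewrite ler_wpM2l // exprVn lef_pV2 ?posrE //.
  by apply: ler_peMl; [exact: ltW|apply: exprn_ege1; lra].
- apply: is_cvg_geometric_series; rewrite gtr0_norm ?invr_gt0 //.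
  by rewrite invf_lt1 //; lra.
Qed.

Definition coordinate psi r p : R := limn (truncation psi r ^~ p).

Lemma truncation_increment_cvg psi r p q : wave psi ->
  `|truncation psi r K p - truncation psi r K q| @[K --> \oo] -->
  `|coordinate psi r p - coordinate psi r q|.
Proof.
move=> wp; apply: cvg_norm; apply: cvgB; exact: truncation_cvg.
Qed.

Lemma truncationB psi r K p q : truncation psi r K p - truncation psi r K q =
  \sum_(0 <= i < K.*2)
    (level psi (coarsest r K * 64 ^+ i) p - level psi (coarsest r K * 64 ^+ i) q).
Proof. by rewrite sumrB. Qed.

Lemma coordinate_le_gauge psi r p q : wave psi ->
  `|coordinate psi r p - coordinate psi r q| <= 9 * grushin_gauge p q.
Proof.
move=> wp; have c := @truncation_increment_cvg psi r p q wp.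
rewrite -(cvg_lim (@Rhausdorff R) c); apply: limr_le; first by apply: cvgP; exact: c.
near=> K; rewrite truncationB.
exact: (level_sum_increment_le (coarsest_gt0 r K)).
Unshelve. all: by end_near. Qed.

(** At a scale [s] in [[X, 2 X]] either [|x - x'| >= D / (4 s)], and the first coordinate
    detects the gauge, or the increment of the level [s], at least [D / (3 s)] for
    one of the waves, exceeds the change [17 / 63 * (D / s)] of the others by
    [4 / 63 * (D / s)]. *)
Lemma gauge_le_coordinate p q : exists r psi,
  [/\ (r < 6)%N, psi = sin \/ psi = (fun a => cos a - 1) &
  grushin_gauge p q <= 33 * Num.max `|p.1 - q.1| `|coordinate psi r p - coordinate psi r q|].
Proof.
set X := grushin_scale p q; set D := `|p.2 - q.2|.
have D0 : 0 <= D by exact: normr_ge0.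
have x0 := normr_ge0 (p.1 - q.1).
have fromx : D / X <= 32 * `|p.1 - q.1| -> exists r psi,
  [/\ (r < 6)%N, psi = sin \/ psi = (fun a => cos a - 1) &
  grushin_gauge p q <= 33 * Num.max `|p.1 - q.1| `|coordinate psi r p - coordinate psi r q|].
  move=> H; exists 0%N, sin; split => //; first by left.
  apply: (@le_trans _ _ (33 * `|p.1 - q.1|)).
    by rewrite /grushin_gauge -/D -/X; lra.
  by rewrite ler_wpM2l // le_max lexx.
have XD : Num.sqrt D <= X by exact: sqrt_snd_le_scale.
have : 0 <= X by apply: le_trans XD; exact: sqrtr_ge0.
rewrite le_eqVlt => /predU1P[X0|X0].
  by apply: fromx; rewrite -X0 invr0 mulr0 mulr_ge0.
have DX : D <= X ^+ 2 by exact: snd_le_scale_sqr.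
have [r [K0 [s [r6 Xs sX scale]]]] := dyadic_scale X0.
have s0 : 0 < s by exact: lt_le_trans Xs.
have DXs : D / X <= 2 * (D / s).
  rewrite ler_pdivrMr // mulrAC -mulrA [X in _ <= X](_ : _ = D * (2 * X / s)).
    by rewrite ler_peMr // ler_pdivlMr // mul1r.
  by field; rewrite lt0r_neq0.
have [xD|xD] := leP (D / (4 * s)) `|p.1 - q.1|.
  apply: fromx; apply: (le_trans DXs).
  have -> : 2 * (D / s) = 8 * (D / (4 * s)) by field; rewrite lt0r_neq0.
  lra.
have DE : `|p.2 / s ^+ 2 - q.2 / s ^+ 2| = D / s ^+ 2.
  by rewrite -mulrBl normrM [X in _ * X]gtr0_norm // invr_gt0 exprn_gt0.
have D1 : D / s ^+ 2 <= 1.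
  rewrite ler_pdivrMr ?exprn_gt0 // mul1r; apply: (le_trans DX).
  by rewrite ler_pXn2r ?nnegrE // ltW.
have [psi [psiE wpsi psige]] : exists psi, [/\ psi = sin \/ psi = (fun a => cos a - 1),
    wave psi & D / s ^+ 2 / 3 <= `|psi (p.2 / s ^+ 2) - psi (q.2 / s ^+ 2)|].
  have := @sin_cos_separate R (p.2 / s ^+ 2) (q.2 / s ^+ 2); rewrite DE => /(_ D1)[H|H].
    by exists sin; split => //; [left|exact: sin_wave].
  by exists (fun a => cos a - 1); split => //; [right|exact: cos_wave].
exists r, psi; split => //.
have low : 4 / 63 * (D / s) <= `|coordinate psi r p - coordinate psi r q|.
  have c := @truncation_increment_cvg psi r p q wpsi.
  rewrite -(cvg_lim (@Rhausdorff R) c); apply: limr_ge; first by apply: cvgP; exact: c.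
  near=> K; have [|i iK iE] := scale K; first by near: K; exact: nbhs_infty_ge.
  rewrite truncationB.
  have := @level_sum_increment_ge R _ (coarsest_gt0 r K) psi p q _ _ wpsi iK X0.
  rewrite iE => /(_ Xs sX xD); have := ler_wpM2l (ltW s0) psige.
  have -> : s * (D / s ^+ 2 / 3) = D / s / 3 by field; rewrite lt0r_neq0.
  rewrite -/D; lra.
have m1 : `|p.1 - q.1| <= Num.max `|p.1 - q.1| `|coordinate psi r p - coordinate psi r q|.
  by rewrite le_max lexx.
have m2 : `|coordinate psi r p - coordinate psi r q| <=
    Num.max `|p.1 - q.1| `|coordinate psi r p - coordinate psi r q|.
  by rewrite le_max lexx orbT.
rewrite /grushin_gauge -/D -/X; lra.
Unshelve. all: by end_near. Qed.

Definition embedding_coordinate (k : nat) p : R :=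
  if k is k'.+1 then
    if (k' < 6)%N then coordinate sin k' p
    else coordinate (fun a => cos a - 1) (k' - 6) p
  else p.1.

Definition embedding p : 'rV[R]_13 := \row_i embedding_coordinate i p.

Lemma coordinate_le_euclidean_dist n (u v : 'rV[R]_n) i :
  `|u ord0 i - v ord0 i| <= euclidean_dist u v.
Proof.
rewrite /euclidean_dist -sqrtr_sqr ler_wsqrtr // (bigD1 i) //= lerDl.
by apply: sumr_ge0 => j _; exact: sqr_ge0.
Qed.

Lemma euclidean_dist_le_bound n (u v : 'rV[R]_n) (c : R) :
  (forall i, `|u ord0 i - v ord0 i| <= c) -> 0 <= c -> euclidean_dist u v <= n%:R * c.
Proof.
move=> H c0; rewrite -[leRHS]ger0_norm ?mulr_ge0 // -sqrtr_sqr ler_wsqrtr //.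
apply: (@le_trans _ _ (\sum_(i < n) c ^+ 2)).
  apply: ler_sum => i _; rewrite -[leLHS]real_normK ?num_real //.
  by rewrite ler_pXn2r ?nnegrE.
rewrite sumr_const card_ord -[leLHS]mulr_natl exprMn.
apply: ler_wpM2r; first exact: sqr_ge0.
by rewrite -natrX ler_nat -mulnn; case: n {u v H} => // n; rewrite leq_pmulr.
Qed.

Lemma euclidean_dist_embedding_le p q :
  euclidean_dist (embedding p) (embedding q) <= 117 * grushin_gauge p q.
Proof.
have g0 : `|p.1 - q.1| <= grushin_gauge p q.
  rewrite lerDl divr_ge0 // /grushin_scale le_max; apply/orP; left; exact: sqrtr_ge0.
have g1 := le_trans (normr_ge0 _) g0.
have -> : 117 * grushin_gauge p q = 13%:R * (9 * grushin_gauge p q) by ring.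
apply: euclidean_dist_le_bound => [i|]; last by rewrite mulr_ge0.
rewrite !mxE /embedding_coordinate; case: (val i) => [|k]; first by lra.
by case: ifP => _; apply: coordinate_le_gauge; [exact: sin_wave|exact: cos_wave].
Qed.

Lemma gauge_le_euclidean_dist p q :
  grushin_gauge p q <= 33 * euclidean_dist (embedding p) (embedding q).
Proof.
have [r [psi [r6 psiE H]]] := gauge_le_coordinate p q.
apply: (le_trans H); rewrite ler_wpM2l // ge_max; apply/andP; split.
  have := coordinate_le_euclidean_dist (embedding p) (embedding q) ord0.
  by rewrite !mxE.
case: psiE => ->.
  have := coordinate_le_euclidean_dist (embedding p) (embedding q) (inord r.+1).
  by rewrite !mxE /embedding_coordinate inordK /= ?r6 // ltnS (ltn_trans r6).
have := coordinate_le_euclidean_dist (embedding p) (embedding q) (inord (r + 6).+1).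
have r13 : ((r + 6).+1 < 13)%N by rewrite ltnS -[12%N]/(6 + 6)%N ltn_add2r.
by rewrite !mxE /embedding_coordinate inordK // ltnNge leq_addl addnK.
Qed.

(** The upper bound has the constant [3 * 117 = 351]; the lower one holds even
    with [8 * 33 = 264]. *)
Lemma embedding_bilipschitz : grushin_bilipschitz_on setT 351 embedding.
Proof.
split; first by lra.
move=> p q _ _; have up := euclidean_dist_embedding_le p q.
have low := gauge_le_euclidean_dist p q.
have d1 := gauge_le_dist p q; have d2 := dist_le_gauge p q.
set e := euclidean_dist _ _ in up low *.
move: d1 d2; case: (grushin_dist p q) => [d| |] //.
  rewrite -!EFinM !lee_fin => d1 d2; split; last by lra.
  by rewrite ler_pdivrMl //; lra.
by rewrite mulrNy gtr0_sg // mul1e leeNy_eq.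
Qed.
End embedding.

Theorem theorem1p1 (R : realType) :
  (exists (N : nat) (C : R) (F : R * R -> 'rV[R]_N),
      grushin_bilipschitz_on setT C F) /\
  (exists (N : R -> nat) (C : R -> R),
    forall L : R, 1 <= L ->
      (exists f : R * R -> 'rV[R]_3,
         grushin_bilipschitz_on (singular_line R) L f) ->
      exists F : R * R -> 'rV[R]_(N L),
        grushin_bilipschitz_on setT (C L) F).
Proof.
split; first by exists 13%N, 351, (@embedding R); exact: embedding_bilipschitz.
exists (fun=> 13%N), (fun=> 351) => L _ _.
by exists (@embedding R); exact: embedding_bilipschitz.
Qed.
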